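(* There exists a function $f:[1,\infty)\to\mathbb{R}$ with $f(x)=0$ for $x\le20$ and \[ f(x)=x\log x-x\log\log\log x+O(x)\qquad(x\ge20), \] such that for all integers $1\le k\le n$, \[ d_{TV}(\mathcal{C}_k,\mathcal{Z}_k)\le e^{-f(n/k)}. \]
   Context: $\mathcal{C}_k=(C_1(\sigma),\ldots,C_k(\sigma))$, where $\sigma$ is a uniformly random permutation in the symmetric group $\mathcal{S}_n$ on $\{1,\ldots,n\}$ and $C_j(\sigma)$ is the number of cycles of length $j$ in $\sigma$. $\mathcal{Z}_k=(Z_1,\ldots,Z_k)$, where $Z_1,\ldots,Z_k$ are independent Poisson random variables with parameters $1,\frac12,\ldots,\frac1k$, respectively. For random variables $X,Y$ taking values in a discrete space $\Omega$, $d_{TV}(X,Y)=\sup_{U\subset\Omega}\big(\mathbb{P}(X\in U)-\mathbb{P}(Y\in U)\big)$. The constant implied by $O(x)$ is absolute. *)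

(* Defs.v *)
From mathcomp Require Import all_boot all_order all_algebra all_fingroup.
From mathcomp Require Import all_classical all_reals all_analysis.

Set Implicit Arguments.
Unset Strict Implicit.
Unset Printing Implicit Defensive.

Import Order.TTheory GRing.Theory Num.Theory.

Local Open Scope classical_set_scope.
Local Open Scope ring_scope.

(* Fixed points are cycles of length 1: they are singletons in [porbits s]. *)
Definition cycle_count (n : nat) (s : 'S_n) (j : nat) : nat :=
  #|[set c in porbits s | #|c| == j]%SET|.

(* Index i : 'I_k carries the cycle length i.+1. *)
Definition cycle_vector (n k : nat) (s : 'S_n) : k.-tuple nat :=
  [tuple cycle_count s (i : 'I_k).+1 | i < k].

Definition uniform_permutation (d : measure_display) (T : measurableType d)
    (R : realType) (P : probability T R) (n : nat) (sigma : T -> 'S_n) : Prop :=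
  forall s : 'S_n, measurable (sigma @^-1` [set s]) /\
    P (sigma @^-1` [set s]) = ((n`!)%:R^-1)%:E.

Definition mutually_independent (d d' : measure_display)
    (T : measurableType d) (T' : measurableType d') (R : realType)
    (P : probability T R) (I : finType) (X : I -> {RV P >-> T'}) : Prop :=
  forall (J : {set I}) (A : I -> set T'), (forall i, measurable (A i)) ->
    P (\bigcap_(i in [set` J]) (X i @^-1` A i)) =
    (\prod_(i in J) P (X i @^-1` A i))%E.

(* The nat argument before the set, here 0, is ignored by
   [poisson_prob]; [nat] carries the discrete sigma-algebra. *)
Definition poisson_distributed (d : measure_display) (T : measurableType d)
    (R : realType) (P : probability T R) (Z : {RV P >-> nat}) (rate : R) :
    Prop :=
  forall A : set nat, distribution P Z A = poisson_prob rate 0%N A.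

Definition joint (T : Type) (k : nat) (Z : 'I_k -> T -> nat) (w : T) :
    k.-tuple nat :=
  [tuple Z i w | i < k].

(* X and Y may live on different probability spaces. Meant for discrete-valued
   X and Y, all of whose preimages are measurable. *)
Definition dTV (d1 d2 : measure_display)
    (T1 : measurableType d1) (T2 : measurableType d2) (R : realType)
    (P : probability T1 R) (Q : probability T2 R) (Omega : Type)
    (X : T1 -> Omega) (Y : T2 -> Omega) : \bar R :=
  ereal_sup [set (P (X @^-1` U) - Q (Y @^-1` U))%E | U in [set: set Omega]].

(* Main.v *)
Require Import Defs.
From mathcomp Require Import all_boot all_order all_algebra all_fingroup.
From mathcomp Require Import all_classical all_reals all_analysis.
From mathcomp Require Import zify ring lra.

Set Implicit Arguments.
Unset Strict Implicit.
Unset Printing Implicit Defensive.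

Import Order.TTheory GRing.Theory Num.Theory.

Local Open Scope classical_set_scope.
Local Open Scope ring_scope.

(** Let [c] be a vector of multiplicities, [c_j] cycles of each length
    [j <= k], and let [weight c = sum_j j c_j] be the number of points that
    these cycles cover. With [h(c) = prod_j 1 / (c_j! j^c_j)] ([cycle_wt]),

      P(C = c) = h(c) rough(n - weight c)    and    Q(Z = c) = h(c) E,

    where [rough m] is the probability that a random permutation of [m] points
    has no cycle of length at most [k] ([rough]), and where
    [E = exp(-(1 + 1/2 + .. + 1/k))] is the probability that [Z] vanishes
    ([poisson_zero]). The first formula ([num_short_cyclesE]) follows by
    building a permutation one point at a time, each new point being inserted
    after an old one in its cycle or left alone.

    Summing over [c] according to its weight, the distance is at most
    [sum_(m <= n) smooth m * |rough (n - m) - E|], where [smooth m] is the sum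
    of [h] over the vectors of weight [m]. Both factors decay like inverse
    factorials, for the same reason: each satisfies a recursion that expresses
    its [m]-th value as [1/m] times a sum of the [k] preceding ones, so that
    going [k] steps further divides it by about [m/k].
    - [m * smooth m] is the sum of the [k] preceding values of [smooth], whence
      [smooth m <= 1 / q!] for [q = m %/ k] ([averaged_le_inv_factorial]).
    - [(i+1) (rough (i+1) - rough i)] is minus the sum of the [k] preceding
      increments of [rough]. Beyond index [k] the increments start at size
      [1/k^2], and not [1/k]; hence [|rough r - rough M|], for [r <= M], is
      [O(1 / (k q!))] with [q] about [r/k] ([rough_tail_pos]), and the factor
      [1/k] pays for the number of terms of the sum above. This is what makes
      the estimate uniform in [k].
    Since [1 / (a! b!) <= 2^(a+b) / (a+b)!], the convolution is at most
    [10 * 8^q / q!] for [q = n %/ k] ([conv_bound]), and Stirling's bound in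
    the form [u^q / q! <= e^u] turns this into [exp (- u log u + O(u))] for
    [u = n/k] ([factorial_tail_bound]).

    It remains to see that [rough] converges to [E]. Both laws have total
    mass one: [sum_(m <= N) smooth m * rough (N - m) = 1] for each [N]
    ([total_mass]), and [E * sum_(m <= N) smooth m] tends to 1
    ([poisson_mass_limit]). The convolution bound lets one replace
    [rough (N - m)] by [rough N] in the first, so that [rough N] and [E] have
    the same limit ([conv_limit_bound]). *)

(** * Permutations without short cycles *)

Section RoughPermutations.
Variables (R : realType) (k : nat).
Hypothesis k_gt0 : (0 < k)%N.

(** The generating function [F(z) = exp (sum_(j > k) z^j / j)] of the
    probabilities that a permutation of [m] points has no cycle of length at
    most [k] satisfies [(1 - z) F'(z) = z^k F(z)]; comparing coefficients gives
    the recursion [roughS] for [rough] below. It reaches [k] steps further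
    back, hence the recursion on a separate bound [fuel >= m]. *)
Fixpoint rough_rec (fuel m : nat) : R :=
  match fuel, m with
  | fuel'.+1, m'.+1 =>
      (m'%:R * rough_rec fuel' m' +
       (if (k <= m')%N then rough_rec fuel' (m' - k) else 0)) / m'.+1%:R
  | _, 0%N => 1
  | 0%N, _.+1 => 0
  end.

Definition rough (m : nat) : R := rough_rec m m.

Lemma rough_recE fuel m : (m <= fuel)%N -> rough_rec fuel m = rough m.
Proof.
suff H f g j : (j <= f)%N -> (j <= g)%N -> rough_rec f j = rough_rec g j.
  by move=> le_mf; apply: H.
elim: f g j => [|f IHf] [|g] [|j] //= jf jg.
rewrite (IHf g j) //; case: ifP => // kj.
by rewrite (IHf g (j - k)%N) //; apply: leq_trans (leq_subr _ _) _.
Qed.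

Lemma rough0 : rough 0%N = 1. Proof. by []. Qed.

Lemma roughS m : m.+1%:R * rough m.+1 =
  m%:R * rough m + (if (k <= m)%N then rough (m - k) else 0).
Proof.
rewrite /rough /= mulrC divfK ?pnatr_eq0 //.
by congr (_ + _); case: ifP => // _; rewrite rough_recE ?leq_subr.
Qed.

Lemma rough_small m : (0 < m <= k)%N -> rough m = 0.
Proof.
elim: m => // m IHm /andP[_ lt_mk]; apply: (@mulfI _ m.+1%:R); first by rewrite pnatr_eq0.
rewrite roughS leqNgt lt_mk mulr0 addr0.
case: m IHm lt_mk => [|m] IHm lt_mk; first by rewrite mul0r.
by rewrite IHm ?mulr0 //= ltnW.
Qed.

Definition rough_step (i : nat) : R := rough i.+1 - rough i.

(** The right-hand side is minus the sum of the [k] steps that precede step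
    [i], so that a step is at most [k / (i+1)] times the largest of them. *)
Lemma rough_stepE i : (k <= i)%N ->
  i.+1%:R * rough_step i = rough (i - k) - rough i.
Proof. by move=> le_ki; rewrite mulrBr roughS le_ki -(natr1 i); ring. Qed.

Lemma rough_diff_le r M (e : R) : (r <= M)%N ->
  (forall i, (r <= i < M)%N -> `|rough_step i| <= e) ->
  `|rough M - rough r| <= (M - r)%:R * e.
Proof.
move=> le_rM He; rewrite -(telescope_sumr _ le_rM).
apply: le_trans (ler_norm_sum _ _ _) _.
rewrite mulr_natl -sumr_const_nat big_nat_cond [leRHS]big_nat_cond.
by apply: ler_sum => i; rewrite andbT => /He.
Qed.

Lemma rough_first : rough k.+1 = k.+1%:R^-1.
Proof.
apply: (@mulfI _ k.+1%:R); first by rewrite pnatr_eq0.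
by rewrite roughS leqnn subnn rough0 rough_small ?k_gt0 ?leqnn // mulr0 add0r divff ?pnatr_eq0.
Qed.

(** Steps 1 to [k-1] vanish and step [k] is [1 / (k+1)]. As long as this one
    large step lies among the [k] preceding ones, that is for [i <= 2k], it
    contributes only [1 / ((k+1) (i+1))], which is of order [1/k^2]; the other
    preceding steps are of that order by induction, and they are few enough
    for the bound not to grow. *)
Lemma rough_step_base i : (k < i)%N -> `|rough_step i| <= (k%:R ^+ 2)^-1.
Proof.
have k0 : 0 < k%:R :> R by rewrite ltr0n.
elim/ltn_ind: i => i IHi lt_ki.
have i0 : 0 < i.+1%:R :> R by rewrite ltr0n.
rewrite -(ler_pM2l i0) -[X in X * `|_|](gtr0_norm i0) -normrM rough_stepE 1?ltnW //.
rewrite distrC; have [le_i2k|lt_2ki] := leqP i (2 * k).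
  rewrite (rough_small (m := i - k)) ?subr0; last by lia.
  have -> : rough i = (rough i - rough k.+1) + rough k.+1 by ring.
  apply: le_trans (ler_normD _ _) _.
  rewrite {2}rough_first (@ger0_norm _ (_^-1)) ?invr_ge0 ?ler0n //.
  have He j : (k.+1 <= j < i)%N -> `|rough_step j| <= (k%:R ^+ 2)^-1.
    by case/andP=> lt_kj lt_ji; apply: IHi.
  apply: le_trans (lerD (rough_diff_le lt_ki He) (lexx _)) _.
  have -> : i.+1%:R = (i - k.+1)%:R + k.+2%:R :> R by rewrite -natrD; congr _%:R; lia.
  rewrite mulrDl lerD2l -[leLHS]mul1r ler_pdivrMr ?ltr0n //.
  rewrite -mulrAC ler_pdivlMr ?exprn_gt0 // mul1r -natrX -natrM ler_nat; nia.
have le_r : (i - k <= i)%N by apply: leq_subr.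
apply: le_trans (rough_diff_le (e := (k%:R ^+ 2)^-1) le_r _) _.
  by move=> j /andP[le_j lt_ji]; apply: IHi => //; lia.
by rewrite ler_wpM2r ?invr_ge0 ?exprn_ge0 ?ler0n // ler_nat; lia.
Qed.

(** One more block of [k] indices gains a factor
    [k / (i+1) <= 1 / (q+1)]. *)
Lemma rough_step_le q i : (0 < q)%N -> (q * k < i)%N ->
  `|rough_step i| <= (k%:R ^+ 2 * q`!%:R)^-1.
Proof.
have k0 : 0 < k%:R :> R by rewrite ltr0n.
elim: q i => // -[_ i _|q IHq i _ lt_qi].
  by rewrite mul1n mulr1; apply: rough_step_base.
have i0 : 0 < i.+1%:R :> R by rewrite ltr0n.
have q0 : 0 < (q.+1)`!%:R :> R by rewrite ltr0n fact_gt0.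
rewrite -(ler_pM2l i0) -[X in X * `|_|](gtr0_norm i0) -normrM rough_stepE; last by lia.
rewrite distrC.
apply: le_trans (rough_diff_le (e := (k%:R ^+ 2 * (q.+1)`!%:R)^-1) (leq_subr _ _) _) _.
  by move=> j /andP[le_j lt_ji]; apply: IHq => //; nia.
rewrite subKn; last by nia.
rewrite (factS q.+1) natrM ler_pdivrMr ?mulr_gt0 ?exprn_gt0 //.
set F := q.+1`!%:R in q0 *.
have -> : i.+1%:R / (k%:R ^+ 2 * (q.+2%:R * F)) * (k%:R ^+ 2 * F) = i.+1%:R / q.+2%:R.
  by field; rewrite !gt_eqF //= addrC natr1 ltr0n.
by rewrite ler_pdivlMr ?ltr0n // -natrM ler_nat; nia.
Qed.

(** A block of [k] steps contributes at most [1 / (k q!)], and the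
    contributions of successive blocks decrease at least as fast as a geometric
    series of ratio [1/2]. *)
Lemma rough_tail q r M : (0 < q)%N -> (q * k < r)%N -> (r <= M)%N ->
  `|rough M - rough r| <= 2 / (k%:R * q`!%:R).
Proof.
have k0 : 0 < k%:R :> R by rewrite ltr0n.
elim/ltn_ind: {M r}(M - r)%N {-2}M {-2}r q (erefl (M - r)%N) => l IHl M r q defl q0 lt_qr le_rM.
have f0 : 0 < q`!%:R :> R by rewrite ltr0n fact_gt0.
have blk M' : (r <= M' <= r + k)%N -> `|rough M' - rough r| <= 1 / (k%:R * q`!%:R).
  case/andP=> le_rM' le_M'.
  apply: le_trans (rough_diff_le (e := (k%:R ^+ 2 * q`!%:R)^-1) le_rM' _) _.
    by move=> j /andP[le_j lt_ji]; apply: rough_step_le => //; lia.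
  have -> : 1 / (k%:R * q`!%:R) = k%:R * (k%:R ^+ 2 * q`!%:R)^-1 :> R.
    by field; rewrite !gt_eqF.
  by rewrite ler_wpM2r ?invr_ge0 ?mulr_ge0 ?exprn_ge0 ?ler0n // ler_nat; lia.
have [le_M|lt_M] := leqP M (r + k).
  apply: le_trans (blk M _) _; first by rewrite le_rM.
  by rewrite ler_wpM2r ?invr_ge0 ?mulr_ge0 ?ler0n // ler1n.
(* From the second block on, [q.+1] replaces [q], and [2 / q.+1 <= 1]. *)
rewrite -(subrKA (rough (r + k))).
apply: le_trans (ler_normD _ _) _.
have -> : 2 / (k%:R * q`!%:R) = 1 / (k%:R * q`!%:R) + 1 / (k%:R * q`!%:R) :> R.
  by field; rewrite !gt_eqF.
rewrite addrC lerD //; first by apply: blk; lia.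
apply: le_trans (IHl (M - (r + k))%N _ M (r + k)%N q.+1 _ _ _ _) _ => //; try by [lia|nia].
rewrite factS natrM.
have -> : 2 / (k%:R * (q.+1%:R * q`!%:R)) = (2 / q.+1%:R) / (k%:R * q`!%:R) :> R.
  by field; rewrite !gt_eqF //= addrC natr1 ltr0n.
rewrite ler_wpM2r ?invr_ge0 ?mulr_ge0 ?ler0n //.
by rewrite ler_pdivrMr ?ltr0n // mul1r ler_nat.
Qed.

(** The block [0 < r <= k], where [q = 0], is not covered by [rough_tail]: there
    [rough r = 0], while [rough M] is itself of order [1/k]. *)
Lemma rough_tail_pos r M : (0 < r)%N -> (r <= M)%N ->
  `|rough M - rough r| <= 3 / (k%:R * ((r.-1) %/ k)`!%:R).
Proof.
have k0 : 0 < k%:R :> R by rewrite ltr0n.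
move=> r0 le_rM; have [q0|] := posnP (r.-1 %/ k); last first.
  move=> q0; apply: le_trans (rough_tail q0 _ le_rM) _.
    by have := leq_divM r.-1 k; lia.
  by rewrite ler_wpM2r ?invr_ge0 ?mulr_ge0 ?ler0n // ler_nat.
have le_rk : (r <= k)%N by move/eqP: q0; rewrite -leqn0 -ltnS ltn_divLR // mul1n; lia.
rewrite q0 fact0 mulr1 (rough_small (m := r)) ?r0 // subr0.
have [le_Mk|lt_kM] := leqP M k.
  by rewrite rough_small ?normr0 ?divr_ge0 ?ler0n //; lia.
rewrite -[rough M](subrK (rough k.+1)).
apply: le_trans (ler_normD _ _) _.
apply: le_trans (lerD (rough_tail (q := 1) _ _ lt_kM) (lexx _)) _ => //; first by rewrite mul1n.
rewrite rough_first (_ : 1`! = 1)%N // mulr1 (@ger0_norm _ (_^-1)) ?invr_ge0 ?ler0n //.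
rewrite (_ : 3 = 2 + 1) ?mulrDl; last by rewrite natr1.
by rewrite lerD2l mul1r lef_pV2 ?posrE ?ltr0n // ler_nat.
Qed.

Lemma rough_tail0 M : `|rough M - rough 0%N| <= 4.
Proof.
have [->|M0] := posnP M; first by rewrite subrr normr0.
rewrite rough0 (_ : 4 = 3 + 1); last by rewrite natr1.
apply: le_trans (ler_normB _ _) _; rewrite normr1 lerD2r.
rewrite -[rough M]subr0 -(rough_small (m := 1)) //.
apply: le_trans (rough_tail_pos _ M0) _ => //.
rewrite div0n fact0 mulr1 ler_pdivrMr ?ltr0n // -natrM ler_nat; lia.
Qed.

End RoughPermutations.

(** * Decay of averaged sequences *)

(** Once the [k] preceding terms are at most [1 / q!], their sum divided by
    [m >= (q+1) k] is at most [1 / (q+1)!]. *)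
Lemma averaged_le_inv_factorial (R : realType) (k : nat) (b : nat -> R) :
  (0 < k)%N -> b 0%N = 1 ->
  (forall m, (0 < m)%N -> m%:R * b m = \sum_(j < minn k m) b (m - j.+1)%N) ->
  forall q m, (q * k <= m)%N -> b m <= q`!%:R^-1.
Proof.
move=> k0 b0 bS; elim=> [|q IHq] m le_qm.
  rewrite fact0 invr1; elim/ltn_ind: m {le_qm} => -[|m] IHm; first by rewrite b0.
  rewrite -(ler_pM2l (_ : 0 < m.+1%:R)) ?ltr0n // bS // mulr1.
  apply: le_trans (ler_sum _ (G := fun=> 1) _) _.
    by move=> j jm; apply: IHm; lia.
  by rewrite sumr_const card_ord ler_nat geq_minr.
have m0 : (0 < m)%N by nia.
rewrite -(ler_pM2l (_ : 0 < m%:R)) ?ltr0n // bS //.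
apply: le_trans (ler_sum _ (G := fun=> q`!%:R^-1) _) _.
  by move=> j _; apply: IHq; have := ltn_ord j; rewrite leq_min; nia.
rewrite sumr_const card_ord -[leLHS]mulr_natl factS natrM invfM mulrA.
rewrite ler_wpM2r ?invr_ge0 ?ler0n //.
by rewrite ler_pdivlMr ?ltr0n // -natrM ler_nat; nia.
Qed.

(** * Inserting a point into a cycle *)

Section Insertion.
Import mathcomp.boot.fintype mathcomp.boot.finset.
Variable T : finType.
Implicit Types (A : {set T}) (s : {perm T}) (x y z : T) (j : nat).
Local Open Scope nat_scope.

Lemma porbitP_iter s y z : reflect (exists i, z = iter i s y) (z \in porbit s y).
Proof.
by apply: (iffP (porbitP s y z)) => -[i ->]; exists i; rewrite permX.
Qed.

Lemma porbit_fix s x : s x = x -> porbit s x = [set x].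
Proof.
move=> sx; apply/setP => z; rewrite inE; apply/porbitP_iter/eqP => [[i ->]|->].
  by elim: i => //= i ->.
by exists 0%N.
Qed.

Lemma porbit_closed s y z : (s z \in porbit s y) = (z \in porbit s y).
Proof. by rewrite -!eq_porbit_mem (porbit_perm s 1). Qed.

Lemma porbit_sub s y (B : {set T}) :
  y \in B -> (forall z, z \in B -> s z \in B) -> porbit s y \subset B.
Proof.
move=> yB sB; apply/subsetP => z /porbitP_iter[i ->].
by elim: i => //= i; apply: sB.
Qed.

(** The permutation [tperm x y * s] sends [y] to [x] and [x] to [s y], and
    agrees with [s] elsewhere: it inserts the fixed point [x] of [s] just after
    [y] in the cycle of [y]. *)
Lemma porbit_insert s x y : s x = x -> x != y ->
  porbit (tperm x y * s)%g y = x |: porbit s y.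
Proof.
move=> sx xy; set t := (_ * s)%g.
have ty : t y = x by rewrite permM tpermR.
have tx : t x = s y by rewrite permM tpermL.
have tz z : z != x -> z != y -> t z = s z.
  by move=> zx zy; rewrite permM tpermD // eq_sym.
have xt : x \in porbit t y by rewrite -ty porbit_closed porbit_id.
apply/eqP; rewrite eqEsubset; apply/andP; split.
  apply: porbit_sub; first by rewrite !inE porbit_id orbT.
  move=> z; rewrite !inE; have [->|zx] := eqVneq z x.
    by rewrite tx porbit_closed porbit_id orbT.
  have [->|zy] := eqVneq z y; first by rewrite ty eqxx.
  by rewrite tz //= porbit_closed => ->; rewrite orbT.
rewrite subUset sub1set xt /=; apply/subsetP => _ /porbitP_iter[i ->].
elim: i => [|i IHi]; first exact: porbit_id.
rewrite /=; set z := iter i s y in IHi *.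
have [->|zy] := eqVneq z y; first by rewrite -tx porbit_closed.
have [->|zx] := eqVneq z x; first by rewrite sx.
by rewrite -tz // porbit_closed.
Qed.

Lemma porbit_other s x y z : s x = x -> z \notin x |: porbit s y ->
  porbit (tperm x y * s)%g z = porbit s z.
Proof.
move=> sx; rewrite !inE => /norP[zx zy].
have stz w : w \in porbit s z -> (tperm x y * s)%g w = s w.
  move=> wz; rewrite permM tpermD //.
    apply: contraNneq zx => xw; rewrite -xw porbit_sym porbit_fix // inE in wz.
    exact: wz.
  by apply: contraNneq zy => ->; rewrite porbit_sym.
apply/eqP; rewrite eqEsubset; apply/andP; split.
  apply: porbit_sub; first exact: porbit_id.
  by move=> w wz; rewrite stz // porbit_closed.
apply/subsetP => _ /porbitP_iter[i ->].
elim: i => [|i IHi] /=; first exact: porbit_id.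
rewrite -[s _]stz ?porbit_closed //.
by apply/porbitP_iter; exists i.
Qed.

Definition cycles_in A s j := #|[set C in porbits s | (C \subset A) && (#|C| == j)]|.

Lemma porbit_in A s y : perm_on A s -> y \in A -> porbit s y \subset A.
Proof. by move=> sA yA; apply: porbit_sub => // z; rewrite perm_closed. Qed.

Lemma porbits_eq s (C : {set T}) z : C \in porbits s -> z \in C -> C = porbit s z.
Proof.
by case/imsetP => w _ -> zw; apply/eqP; rewrite eq_sym eq_porbit_mem.
Qed.

Lemma porbits_nonempty s (C : {set T}) : C \in porbits s -> exists2 z, z \in C & C = porbit s z.
Proof. by case/imsetP => w _ ->; exists w => //; exact: porbit_id. Qed.

Lemma sub_setU1 x A (C : {set T}) : x \notin C -> (C \subset x |: A) = (C \subset A).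
Proof.
move=> xC; apply/idP/idP => [/subsetP CA|/subset_trans]; last by apply; exact: subsetUr.
by apply/subsetP => z zC; have:= CA z zC; rewrite !inE; case: eqVneq zC xC => // -> ->.
Qed.

Lemma cycles_in_id A s x j : perm_on A s -> x \notin A ->
  cycles_in (x |: A) s j = cycles_in A s j + (j == 1).
Proof.
move=> sA xA; have sx : s x = x by apply: out_perm sA xA.
rewrite /cycles_in (cardsD1 [set x]) addnC; congr (_ + _).
  apply: eq_card => C; rewrite !inE.
  have [Cs|] /= := boolP (C \in porbits s); last by rewrite andbF.
  have [xC|xC] := boolP (x \in C).
    rewrite (porbits_eq Cs xC) porbit_fix // eqxx /= sub1set (negPf xA) //.
  have -> : C != [set x] by apply: contraNneq xC => ->; rewrite set11.
  by rewrite sub_setU1.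
rewrite !inE -(porbit_fix sx) imset_f //= porbit_fix // cards1.
by rewrite sub1set setU11 eq_sym.
Qed.

(** A cycle of the length of the cycle of [y] is lost and a cycle one longer is
    gained; both corrections are additive, which avoids the truncated
    subtraction. *)
Lemma cycles_in_insert A s x y j : perm_on A s -> x \notin A -> y \in A ->
  cycles_in (x |: A) (tperm x y * s)%g j + (j == #|porbit s y|) =
  cycles_in A s j + (j == #|porbit s y|.+1).
Proof.
move=> sA xA yA; have sx : s x = x by apply: out_perm sA xA.
have xy : x != y by apply: contraNneq xA => ->.
set t := (tperm x y * s)%g.
have ty := porbit_insert sx xy; rewrite -/t in ty.
have xsy : x \notin porbit s y.
  by apply: contra xA; apply/subsetP/porbit_in.
rewrite /cycles_in (cardsD1 (porbit t y)) addnC [in RHS](cardsD1 (porbit s y)).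
rewrite [in RHS]addnC addnA [RHS]addnA; congr (_ + _).
  rewrite !inE !imset_f //= ty cardsU1 xsy add1n.
  rewrite subUset sub1set setU11 subsetU (porbit_in sA yA) ?orbT //=.
  by rewrite ![_ == j]eq_sym addnC.
apply: eq_card => C; rewrite !inE ty.
apply/andP/andP => -[CN /and3P[Cs CA Cj]].
  have [z zC Cz] := porbits_nonempty Cs.
  have zN : z \notin x |: porbit s y.
    apply: contra CN; rewrite -ty => zt; apply/eqP.
    by rewrite Cz; apply/eqP; rewrite eq_porbit_mem.
  have CE : C = porbit s z by rewrite Cz porbit_other.
  move: zN; rewrite !inE => /norP[zx zy].
  have xC : x \notin C by rewrite CE porbit_sym porbit_fix // inE.
  by rewrite Cj andbT -(sub_setU1 A xC) CA CE imset_f // eq_porbit_mem.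
have [z zC Cz] := porbits_nonempty Cs.
have zA : z \in A by apply: (subsetP CA).
have zN : z \notin x |: porbit s y.
  rewrite !inE negb_or -eq_porbit_mem -Cz CN andbT.
  by apply: contraNneq xA => <-.
have CE : C = porbit t z by rewrite Cz porbit_other.
split; first by apply: contraNneq zN => <-.
by rewrite Cj (subset_trans CA) ?subsetUr // CE imset_f.
Qed.

Lemma card_points_cycles A s j : perm_on A s ->
  #|[set y in A | #|porbit s y| == j]| = j * cycles_in A s j.
Proof.
move=> sA; rewrite /cycles_in; set P := [set C in porbits s | _].
have trP : trivIset P.
  apply/trivIsetP => B C; rewrite !inE => /andP[Bs _] /andP[Cs _] BC.
  apply/pred0P => z /=; apply: contraNF BC => /andP[zB zC].
  by rewrite (porbits_eq Bs zB) (porbits_eq Cs zC).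
have uP : {in P, forall C : {set T}, #|C| = j}.
  by move=> C; rewrite inE => /and3P[_ _ /eqP].
rewrite mulnC -(card_uniform_partition uP (D := cover P)); last first.
  rewrite /partition eqxx trP; apply/negP; rewrite inE => /andP[/porbits_nonempty[z]].
  by rewrite inE.
apply: eq_card => y; rewrite inE; apply/andP/bigcupP => [[yA yj]|[C]].
  exists (porbit s y); last exact: porbit_id.
  by rewrite inE imset_f // porbit_in.
rewrite inE => /and3P[Cs CA Cj] yC; split; first exact: (subsetP CA).
by rewrite -(porbits_eq Cs yC).
Qed.

(** A permutation [t] of [x |: A] arises from exactly one insertion: [y] is the
    preimage of [x] under [t] (with [y = x] when [t] fixes [x]), and
    [tperm x y * t] fixes [x]. *)
Lemma sum_perm_insert (R : nmodType) A x (F : {perm T} -> R) : x \notin A ->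
  (\sum_(s | perm_on (x |: A) s) F s =
   \sum_(s | perm_on A s) \sum_(y in x |: A) F (tperm x y * s)%g)%R.
Proof.
move=> xA.
rewrite (partition_big (fun s => s^-1%g x) (mem (x |: A))) /=; last first.
  by move=> s sA; rewrite perm_closed ?setU11 // perm_onV.
rewrite exchange_big /=; apply: eq_bigr => y yA.
rewrite (reindex_inj (mulgI (tperm x y))) /=; apply: eq_bigl => s.
rewrite invMg permM tpermV.
apply/andP/idP => [[ts /eqP tsx]|sA].
  have sx : s x = x.
    by move/(congr1 (tperm x y)): tsx; rewrite tpermK tpermR => h; rewrite -{1}h permKV.
  apply/subsetP => z; rewrite inE => sz.
  have zx : z != x by apply: contraNneq sz => ->; rewrite sx.
  have [zy|zy] := eqVneq z y.
    by move: yA; rewrite -zy !inE (negPf zx).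
  apply: contraTT isT => zA.
  have: (tperm x y * s)%g z = z by apply: out_perm ts _; rewrite !inE negb_or zx.
  by rewrite permM tpermD // 1?eq_sym // => /eqP; rewrite (negPf sz).
have sx : s x = x by apply: out_perm sA xA.
split; last first.
  by apply/eqP; rewrite (canLR (permK s) (esym sx)) tpermL.
apply: perm_onM; last by apply: subset_trans sA (subsetUr _ _).
by apply: subset_trans (tperm_on x y) _; rewrite subUset !sub1set setU11.
Qed.
End Insertion.

(** * Multiplicities of short cycles *)

Section Multiplicities.
Variables (R : realType) (k : nat).
Implicit Types (c : {ffun 'I_k -> nat}) (j : 'I_k).

(** In a vector [c : {ffun 'I_k -> nat}] the index [i] carries the cycle length
    [i.+1]. *)
Definition add_cycle j c : {ffun 'I_k -> nat} := [ffun i => (c i + (i == j))%N].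
Definition weight c : nat := (\sum_(i < k) i.+1 * c i)%N.
(** Cauchy's formula: the probability that a permutation of [weight c] points has
    cycle multiplicities [c]; also, up to the factor [poisson_zero], the mass of
    [c] under the product of the Poisson laws of parameters [1 / i.+1]. *)
Definition cycle_wt c : R := \prod_(i < k) ((c i)`!%:R * i.+1%:R ^+ c i)^-1.

Lemma add_cycle_inj j : injective (add_cycle j).
Proof.
move=> c d /ffunP cd; apply/ffunP => i.
by have := cd i; rewrite !ffunE => /addIn.
Qed.

Lemma add_cycleC i j c : add_cycle i (add_cycle j c) = add_cycle j (add_cycle i c).
Proof. by apply/ffunP => l; rewrite !ffunE addnAC. Qed.

Lemma add_cycleE j c : add_cycle j c j = (c j).+1.
Proof. by rewrite ffunE eqxx addn1. Qed.

Lemma add_cycle_pred j c : (0 < c j)%N -> exists d, c = add_cycle j d.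
Proof.
move=> cj; exists [ffun i => (c i - (i == j))%N]; apply/ffunP => i.
by rewrite !ffunE; case: eqVneq => [->|_]; rewrite ?subn0 ?addn0 // subnK.
Qed.

Lemma weight_add_cycle j c : weight (add_cycle j c) = (weight c + j.+1)%N.
Proof.
rewrite /weight [LHS](bigD1 j) //= [in RHS](bigD1 j) //= add_cycleE.
under eq_bigr => i ij do rewrite ffunE (negPf ij) addn0.
by rewrite mulnS; lia.
Qed.

Lemma cycle_wt_add_cycle j c : cycle_wt c = j.+1%:R * (c j).+1%:R * cycle_wt (add_cycle j c).
Proof.
rewrite /cycle_wt [LHS](bigD1 j) //= [in RHS](bigD1 j) //= add_cycleE mulrA.
under [in RHS]eq_bigr => i ij do rewrite ffunE (negPf ij) addn0.
congr (_ * _); rewrite factS natrM exprS; field.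
by rewrite !gt_eqF ?exprn_gt0 ?ltr0n ?fact_gt0 // -natrD ltr0n.
Qed.

Lemma cycle_wt_gt0 c : 0 < cycle_wt c.
Proof. by apply: prodr_gt0 => i _; rewrite invr_gt0 mulr_gt0 ?exprn_gt0 ?ltr0n ?fact_gt0. Qed.

Lemma coord_le_weight c i : (c i <= weight c)%N.
Proof. by rewrite /weight (bigD1 i) //=; nia. Qed.

(** The vectors of weight [m] have entries at most [m], hence the enumeration
    through functions into ['I_m.+1]. *)
Definition of_weight m : seq {ffun 'I_k -> nat} :=
  [seq c <- [seq [ffun i => val (f i)] | f : {ffun 'I_k -> 'I_m.+1}] | weight c == m].

Lemma mem_of_weight m c : (c \in of_weight m) = (weight c == m).
Proof.
rewrite mem_filter andb_idr // => /eqP wm.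
apply/mapP; exists [ffun i => inord (c i)]; first by rewrite mem_enum.
by apply/ffunP => i; rewrite !ffunE /= inordK // ltnS -wm coord_le_weight.
Qed.

Lemma of_weight_uniq m : uniq (of_weight m).
Proof.
apply: filter_uniq; rewrite map_inj_uniq ?enum_uniq // => f g /ffunP fg.
by apply/ffunP => i; apply/val_inj; have := fg i; rewrite !ffunE.
Qed.

Definition smooth m : R := \sum_(c <- of_weight m) cycle_wt c.

Lemma smooth_ge0 m : 0 <= smooth m.
Proof. by apply: sumr_ge0 => c _; apply/ltW/cycle_wt_gt0. Qed.

Lemma smooth0 : smooth 0%N = 1.
Proof.
pose z : {ffun 'I_k -> nat} := [ffun=> 0%N].
have perm0 : perm_eq (of_weight 0%N) [:: z].
  apply: uniq_perm; rewrite ?of_weight_uniq // => c; rewrite mem_of_weight inE.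
  apply/eqP/eqP => [wc|->]; last by apply: big1 => i _; rewrite ffunE muln0.
  by apply/ffunP => i; rewrite ffunE; apply/eqP; rewrite -leqn0 -wc coord_le_weight.
rewrite /smooth (perm_big _ perm0) big_seq1 /cycle_wt big1 // => i _.
by rewrite ffunE fact0 expr0 mulr1 invr1.
Qed.

(** Writing [m] as [sum_i i.+1 * c i], it suffices to remove one cycle of length
    [i.+1] from the vectors that have one; this multiplies [cycle_wt c] by
    [i.+1 * c i], which is [cycle_wt_add_cycle]. *)
Lemma smooth_rec m : m%:R * smooth m = \sum_(j < minn k m) smooth (m - j.+1)%N.
Proof.
rewrite mulr_sumr.
transitivity (\sum_(i < k) \sum_(c <- of_weight m) i.+1%:R * (c i)%:R * cycle_wt c).
  rewrite exchange_big /= big_seq [RHS]big_seq; apply: eq_bigr => c.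
  rewrite mem_of_weight => /eqP <-; rewrite -mulr_suml; congr (_ * _).
  by rewrite natr_sum; apply: eq_bigr => i _; rewrite natrM.
transitivity (\sum_(i < k | (i < m)%N) smooth (m - i.+1)%N); last first.
  rewrite (big_ord_widen_cond k predT (fun i => smooth (m - i.+1)%N)) ?geq_minl //.
  by apply: eq_bigl => i; rewrite /= ltn_min ltn_ord.
rewrite [RHS]big_mkcond; apply: eq_bigr => i _.
rewrite (bigID (fun c : {ffun _ -> _} => 0 < c i)%N) /= [X in _ + X]big1 ?addr0; last first.
  by move=> c; rewrite -eqn0Ngt => /eqP ->; rewrite mulr0 mul0r.
case: ltnP => [lt_im|le_mi]; last first.
  rewrite big_seq_cond big1 // => c /andP[]; rewrite mem_of_weight => /eqP wc ci.
  have [d cd] := add_cycle_pred ci; move: wc; rewrite cd weight_add_cycle; lia.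
rewrite -big_filter (perm_big (map (add_cycle i) (of_weight (m - i.+1)%N))) /=.
  rewrite big_map; apply: eq_bigr => c _; by rewrite add_cycleE -cycle_wt_add_cycle.
apply: uniq_perm; first by rewrite filter_uniq ?of_weight_uniq.
  by rewrite map_inj_uniq ?of_weight_uniq //; apply: add_cycle_inj.
move=> c; rewrite mem_filter mem_of_weight; apply/andP/mapP => [[ci /eqP wc]|[d]].
  have [d cd] := add_cycle_pred ci; exists d => //.
  by rewrite mem_of_weight; move: wc; rewrite cd weight_add_cycle; lia.
rewrite mem_of_weight => /eqP wd ->; rewrite add_cycleE weight_add_cycle wd; split => //.
by apply/eqP; lia.
Qed.

End Multiplicities.

(** * The law of the short cycles of a random permutation *)

Section CycleLaw.
Variables (R : realType) (T : finType).
Import mathcomp.boot.fintype mathcomp.boot.finset.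
Implicit Types (A : {set T}) (s : {perm T}) (x y : T).

Definition short_cycles k A s : {ffun 'I_k -> nat} :=
  [ffun i => cycles_in A s (i : 'I_k).+1].

Definition num_short_cycles k A (c : {ffun 'I_k -> nat}) : R :=
  \sum_(s | perm_on A s) (short_cycles k A s == c)%:R.

(** The probability that the points left over by short cycles of total weight [w]
    form only long cycles; it vanishes when there are not enough points. *)
Definition rough_rest k m (w : nat) : R :=
  if (w <= m)%N then rough R k (m - w)%N else 0.

(** The number of points of [A] in cycles of length [l] is [l] times the number of
    these cycles, and a function that is constant on lengths above [k] sees the
    longer cycles only through the number of points that they cover. *)
Lemma sum_by_length k A s (G : nat -> R) (g : R) : perm_on A s ->
  (forall l, (k < l)%N -> G l = g) ->
  \sum_(y in A) G #|porbit s y| =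
  \sum_(i < k) i.+1%:R * (short_cycles k A s i)%:R * G i.+1 +
  (#|A|%:R - (weight (short_cycles k A s))%:R) * g.
Proof.
move=> sA Gg.
have cardE (i : 'I_k) : i.+1%:R * (short_cycles k A s i)%:R =
    \sum_(y in A) (#|porbit s y| == i.+1)%:R :> R.
  rewrite ffunE -natrM -card_points_cycles // -sum1_card natr_sum.
  rewrite big_mkcond [RHS]big_mkcond; apply: eq_bigr => y _.
  by rewrite inE; case: (y \in A) => //=; case: eqP.
have -> : (weight (short_cycles k A s))%:R =
    \sum_(i < k) i.+1%:R * (short_cycles k A s i)%:R :> R.
  by rewrite /weight natr_sum; apply: eq_bigr => i _; rewrite natrM.
transitivity (\sum_(y in A) (\sum_(i < k) (#|porbit s y| == i.+1)%:R * (G i.+1 - g) + g)).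
  apply: eq_bigr => y _.
  have := card_porbit_neq0 s y; case: #|porbit s y| => // l _.
  have [lt_lk|le_kl] := ltnP l k.
    rewrite (bigD1 (Ordinal lt_lk)) //= eqxx mul1r big1 ?addr0 ?subrK // => i.
    by rewrite -val_eqE /= eqSS eq_sym => /negPf ->; rewrite mul0r.
  rewrite big1 ?add0r; first by rewrite Gg.
  by move=> i _; rewrite eqSS gtn_eqF ?mul0r //; apply: leq_trans le_kl.
rewrite big_split /= sumr_const exchange_big /= mulrBl -[g *+ _]mulr_natl.
rewrite [RHS]addrA [RHS]addrAC; congr (_ + _); rewrite mulr_suml -sumrB.
by apply: eq_bigr => i _; rewrite -mulr_suml -cardE; ring.
Qed.

Lemma weight_short_cycles k A s : perm_on A s -> (weight (short_cycles k A s) <= #|A|)%N.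
Proof.
move=> sA; rewrite -(ler_nat R) -subr_ge0.
have := @sum_by_length k A s (fun l => (k < l)%N%:R) 1 sA.
rewrite mulr1 [X in _ = X + _]big1 ?add0r.
  by move=> <-; [apply: sumr_ge0 => y _; rewrite ler0n | move=> l ->].
by move=> i _; rewrite ltnNge ltn_ord mulr0.
Qed.

Lemma short_cycles_id k A s x : perm_on A s -> x \notin A ->
  short_cycles k.+1 (x |: A) s = add_cycle ord0 (short_cycles k.+1 A s).
Proof.
by move=> sA xA; apply/ffunP => i; rewrite !ffunE cycles_in_id // eqSS.
Qed.

Lemma short_cycles_insert k A s x y (c : {ffun 'I_k.+1 -> nat}) :
  perm_on A s -> x \notin A -> y \in A ->
  (short_cycles k.+1 (x |: A) (tperm x y * s)%g == c) =
  [forall i : 'I_k.+1, short_cycles k.+1 A s i + (i == #|porbit s y| :> nat) ==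
                     c i + (i.+1 == #|porbit s y|)]%N.
Proof.
move=> sA xA yA; apply/eqP/forallP => [<- i|H].
  by rewrite !ffunE cycles_in_insert // eqSS.
apply/ffunP => i; have := H i; rewrite !ffunE => /eqP E.
by apply: (@addIn (i.+1 == #|porbit s y|)); rewrite -E cycles_in_insert // eqSS.
Qed.

(** The new point [x] is left alone, or joins a cycle of length [i.+1 <= k],
    which becomes one longer, or joins a cycle of length [k.+1], which
    is no longer short, or joins a cycle that was already long. *)
Lemma num_short_cycles_rec k A x (c : {ffun 'I_k.+1 -> nat}) : x \notin A ->
  num_short_cycles (x |: A) c = \sum_(s | perm_on A s)
   ((add_cycle ord0 (short_cycles k.+1 A s) == c)%:R +
    (\sum_(i < k) i.+1%:R * (short_cycles k.+1 A s (widen_ord (leqnSn k) i))%:R *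
       (add_cycle (lift ord0 i) (short_cycles k.+1 A s) == add_cycle (widen_ord (leqnSn k) i) c)%:R +
     k.+1%:R * (short_cycles k.+1 A s ord_max)%:R * (short_cycles k.+1 A s == add_cycle ord_max c)%:R +
     (#|A|%:R - (weight (short_cycles k.+1 A s))%:R) * (short_cycles k.+1 A s == c)%:R)).
Proof.
move=> xA; rewrite /num_short_cycles sum_perm_insert //; apply: eq_bigr => s sA.
rewrite big_setU1 //= tperm1 mul1g short_cycles_id //; congr (_ + _).
pose G l : R := [forall i : 'I_k.+1, short_cycles k.+1 A s i + (i == l :> nat) ==
                     c i + (i.+1 == l)]%N%:R.
under eq_bigr => y yA do rewrite short_cycles_insert //.
rewrite (@sum_by_length k.+1 A s G (short_cycles k.+1 A s == c)%:R) //; last first.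
  move=> l lt_kl; have l1 (i : 'I_k.+1) : (i == l :> nat) = false.
    by apply/eqP; have := ltn_ord i; lia.
  have l2 (i : 'I_k.+1) : (i.+1 == l) = false by apply/eqP; have := ltn_ord i; lia.
  congr (_%:R); congr (nat_of_bool _); apply/forallP/eqP => [H|-> i]; last by rewrite l1 l2.
  by apply/ffunP => i; have /eqP := H i; rewrite l1 l2 !addn0.
congr (_ + _); rewrite big_ord_recr /=; congr (_ + _).
  apply: eq_bigr => i _; congr (_ * _%:R); congr (nat_of_bool _).
  apply/forallP/eqP => [H|/ffunP H j];
    [apply/ffunP => j; have /eqP := H j | apply/eqP; have := H j];
  by rewrite !ffunE -!val_eqE /= /bump /= add1n eqSS.
congr (_ * _%:R); congr (nat_of_bool _).
have lt_j (j : 'I_k.+1) : (j == k.+1 :> nat) = false by rewrite ltn_eqF.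
apply/forallP/eqP => [H|/ffunP H j].
  by apply/ffunP => j; have /eqP := H j; rewrite !ffunE -!val_eqE /= eqSS lt_j addn0.
by apply/eqP; have := H j; rewrite !ffunE -!val_eqE /= eqSS lt_j addn0.
Qed.

(** The recursion [roughS], in the form in which the insertion of a point
    produces it. *)
Lemma rough_restS k m w :
  (m.+1%:R - w%:R) * rough_rest k m.+1 w =
  rough_rest k m (w + k) + (m%:R - w%:R) * rough_rest k m w.
Proof.
rewrite /rough_rest; have [le_wm|lt_mw] := leqP w m.
  rewrite leqW // (subSn le_wm) -!natrB // ?(leqW le_wm) //.
  rewrite (subSn le_wm) roughS addrC; congr (_ + _).
  by rewrite -leq_subRL //; case: ifP => // _; rewrite subnDA.
rewrite (_ : w + k <= m = false)%N ?mulr0 ?addr0; last by lia.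
case: (leqP w m.+1) => [le_wm|_]; last by rewrite mulr0.
have -> : w = m.+1 by lia.
by rewrite subrr mul0r.
Qed.

(** Insert the last point. The permutations in which its cycle acquires the short
    length [j] contribute the proportion [j c_j / #|A|], by [cycle_wt_add_cycle] and
    induction; over all [j] this adds up to [weight c / #|A|]. The two remaining terms
    of [num_short_cycles_rec] contribute, by [rough_restS], the complementary
    proportion [1 - weight c / #|A|]. *)
Lemma num_short_cyclesE k A (c : {ffun 'I_k.+1 -> nat}) :
  num_short_cycles A c = (#|A|)`!%:R * cycle_wt R c * rough_rest k.+1 #|A| (weight c).
Proof.
have [m] := ubnP #|A|; elim: m A c => // m IHm A c; rewrite ltnS => leAm.
have [->|/set0Pn[x xA]] := eqVneq A set0.
  rewrite /num_short_cycles cards0 fact0 mul1r (big_pred1 1%g); last first.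
    move=> s; apply/idP/eqP => [s0|->]; last exact: perm_on1.
    by apply/permP => z; rewrite perm1 (out_perm s0) ?inE.
  have -> : short_cycles k.+1 set0 1%g = [ffun=> 0%N].
    apply/ffunP => i; rewrite !ffunE; apply/eqP; rewrite cards_eq0; apply/eqP/setP => C.
    rewrite !inE subset0; have [->|_] := eqVneq C set0; last by rewrite andbF.
    by rewrite cards0 andbF.
  rewrite /rough_rest leqn0; have [w0|w0] := eqVneq (weight c) 0%N.
    have -> : c = [ffun=> 0%N].
      apply/ffunP => i; rewrite ffunE; apply/eqP; rewrite -leqn0 -w0; exact: coord_le_weight.
    rewrite eqxx sub0n rough0 mulr1 /cycle_wt big1 // => i _.
    by rewrite ffunE fact0 expr0 mulr1 invr1.
  rewrite mulr0; case: eqP => // c0; case/eqP: w0; rewrite -c0.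
  by apply: big1 => i _; rewrite ffunE muln0.
(* The inductive step removes [x] from [A]. *)
have AE : A = x |: (A :\ x) by rewrite setD1K.
set B := A :\ x in AE; have xB : x \notin B by rewrite !inE eqxx.
have cA : #|A| = #|B|.+1 by rewrite AE cardsU1 xB.
have {}IHm (d : {ffun 'I_k.+1 -> nat}) :
    num_short_cycles B d = (#|B|)`!%:R * cycle_wt R d * rough_rest k.+1 #|B| (weight d).
  by apply: IHm; rewrite -cA.
rewrite cA AE num_short_cycles_rec // !big_split /=; set n := #|B| in IHm *.
pose Q := n`!%:R * cycle_wt R c : R.
have t0 : \sum_(s | perm_on B s) (add_cycle ord0 (short_cycles k.+1 B s) == c)%:R =
    Q * (c ord0)%:R * rough_rest k.+1 n.+1 (weight c).
  have [c0|c0] := posnP (c ord0).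
    rewrite c0 mulr0 mul0r big1 // => s _; case: eqP => // E.
    by move: c0; rewrite -E add_cycleE.
  have [d cd] := add_cycle_pred c0; rewrite /Q cd.
  under eq_bigr do rewrite (inj_eq (@add_cycle_inj _ ord0)).
  rewrite [LHS]IHm (cycle_wt_add_cycle _ ord0 d)
    weight_add_cycle addn1 add_cycleE /rough_rest ltnS subSS.
  by rewrite /= mul1r; ring.
have ti (i : 'I_k) : \sum_(s | perm_on B s)
    i.+1%:R * (short_cycles k.+1 B s (widen_ord (leqnSn k) i))%:R *
       (add_cycle (lift ord0 i) (short_cycles k.+1 B s) == add_cycle (widen_ord (leqnSn k) i) c)%:R =
    Q * (i.+2%:R * (c (lift ord0 i))%:R) * rough_rest k.+1 n.+1 (weight c).
  set j := lift ord0 i; set j' := widen_ord _ i.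
  have jE : j = i.+1 :> nat by [].
  have j'E : j' = i :> nat by [].
  have [c0|c0] := posnP (c j).
    rewrite c0 mulr0 mulr0 mul0r big1 // => s _.
    case: eqP => [/ffunP/(_ j)|_]; last by rewrite mulr0.
    by rewrite add_cycleE [add_cycle j' c j]ffunE c0 -val_eqE /= /bump /= add1n gtn_eqF.
  have [d cd] := add_cycle_pred c0; rewrite /Q cd.
  transitivity (\sum_(s | perm_on B s) i.+1%:R * (add_cycle j' d j')%:R *
       (short_cycles k.+1 B s == add_cycle j' d)%:R : R).
    apply: eq_bigr => s _; rewrite add_cycleC (inj_eq (@add_cycle_inj _ j)).
    by case: eqP => [->|] //; rewrite !mulr0.
  rewrite -mulr_sumr [X in _ * X]IHm !add_cycleE !weight_add_cycle.
  have -> : rough_rest k.+1 n.+1 (weight d + j.+1) = rough_rest k.+1 n (weight d + j'.+1).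
    by rewrite jE j'E addnS /rough_rest ltnS subSS.
  transitivity (n`!%:R * cycle_wt R d * rough_rest k.+1 n (weight d + j'.+1)).
    by rewrite (cycle_wt_add_cycle _ j' d) j'E; ring.
  by rewrite (cycle_wt_add_cycle _ j d) jE; ring.
have tk : \sum_(s | perm_on B s)
    k.+1%:R * (short_cycles k.+1 B s ord_max)%:R * (short_cycles k.+1 B s == add_cycle ord_max c)%:R =
    Q * rough_rest k.+1 n (weight c + k.+1)%N.
  transitivity (\sum_(s | perm_on B s) k.+1%:R * (add_cycle ord_max c ord_max)%:R *
       (short_cycles k.+1 B s == add_cycle ord_max c)%:R : R).
    by apply: eq_bigr => s _; case: eqP => [->|] //; rewrite !mulr0.
  rewrite -mulr_sumr [X in _ * X]IHm /Q add_cycleE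
    (cycle_wt_add_cycle _ ord_max c) weight_add_cycle /=; ring.
have tr : \sum_(s | perm_on B s)
    (n%:R - (weight (short_cycles k.+1 B s))%:R) * (short_cycles k.+1 B s == c)%:R =
    Q * ((n%:R - (weight c)%:R) * rough_rest k.+1 n (weight c)).
  transitivity (\sum_(s | perm_on B s) (n%:R - (weight c)%:R) * (short_cycles k.+1 B s == c)%:R : R).
    by apply: eq_bigr => s _; case: eqP => [->|] //; rewrite !mulr0.
  rewrite -mulr_sumr [X in _ * X]IHm /Q; ring.
rewrite exchange_big /= (eq_bigr _ (fun i _ => ti i)) t0 tk tr.
have wE : (weight c)%:R = (c ord0)%:R + \sum_(i < k) i.+2%:R * (c (lift ord0 i))%:R :> R.
  rewrite /weight big_ord_recl natrD mul1n natr_sum; congr (_ + _).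
  by apply: eq_bigr => i _; rewrite natrM.
rewrite -!mulr_suml -!mulr_sumr factS natrM.
move: (rough_restS k.+1 n (weight c)); set r := rough_rest _ _.+1 _.
set S := \sum_(i < k) _ in wE *; move=> E.
transitivity (Q * ((c ord0)%:R * r + S * r + (rough_rest k.+1 n (weight c + k.+1)%N +
   (n%:R - (weight c)%:R) * rough_rest k.+1 n (weight c)))); first by ring.
rewrite -E wE /Q; ring.
Qed.
End CycleLaw.

(** * The convolution that bounds the distance *)

Section Convolution.
Variables (R : realType) (k : nat).
Local Notation K := k.+1.
Local Notation smooth := (smooth R K).
Local Notation rough := (rough R K).

Lemma smooth_factorial q m : (q * K <= m)%N -> smooth m <= q`!%:R^-1.
Proof.
by apply: averaged_le_inv_factorial => // [|{}m m0]; [exact: smooth0 | exact: smooth_rec].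
Qed.

Lemma num_short_cycles_Sn n (c : {ffun 'I_K -> nat}) :
  \sum_(s : 'S_n) (short_cycles K [set: 'I_n]%SET s == c)%:R =
  n`!%:R * cycle_wt R c * rough_rest R K n (weight c).
Proof.
have := num_short_cyclesE R [set: 'I_n]%SET c; rewrite cardsT card_ord => <-.
rewrite /num_short_cycles; apply: eq_bigl => s; apply/esym/fintype.subsetP => z _.
by rewrite inE.
Qed.

(** This is the total mass of the law of the short cycles of a permutation of
    [n] points. *)
Lemma total_mass n : \sum_(m < n.+1) smooth m * rough (n - m) = 1.
Proof.
apply: (@mulfI _ n`!%:R); first by rewrite pnatr_eq0 -lt0n fact_gt0.
rewrite mulr1 -[in RHS]card_Sn -sum1_card natr_sum.
transitivity (\sum_(s : 'S_n) \sum_(m < n.+1) \sum_(c <- of_weight K m)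
     (short_cycles K [set: 'I_n]%SET s == c)%:R : R); last first.
  apply: eq_bigr => s _; set c := short_cycles _ _ _.
  have wn : (weight c < n.+1)%N.
    rewrite ltnS -[leqRHS]card_ord -cardsT; apply: weight_short_cycles => //.
    by apply/fintype.subsetP => z _; rewrite inE.
  have cE m : \sum_(d <- of_weight K m) (c == d)%:R = (weight c == m)%:R :> R.
    rewrite -mem_of_weight; have [cm|cm] := boolP (c \in _).
      rewrite (bigD1_seq c) ?of_weight_uniq //= eqxx big1 ?addr0 // => d.
      by rewrite eq_sym => /negPf ->.
    rewrite big_seq big1 // => d dm; case: eqP => // cd.
    by rewrite cd dm in cm.
  rewrite (bigD1 (Ordinal wn)) //= cE eqxx big1 ?addr0 // => m.
  by rewrite cE -val_eqE /= eq_sym => /negPf ->.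
rewrite mulr_sumr exchange_big /=; apply: eq_bigr => m _.
rewrite exchange_big /= mulr_suml mulr_sumr big_seq [RHS]big_seq.
apply: eq_bigr => c; rewrite mem_of_weight => /eqP wc.
by rewrite num_short_cycles_Sn /rough_rest wc -ltnS ltn_ord mulrA.
Qed.

(** The binomial coefficient of [a + b] over [a] is at most [2 ^ (a + b)]. The slack
    of one between [a + b] and [q] absorbs the rounding in quotients by [k]. *)
Lemma inv_fact_mul_le a b q : (q <= (a + b).+1)%N -> (a + b <= q)%N -> (0 < q)%N ->
  (a`!%:R * b`!%:R)^-1 <= 2 ^+ q * q%:R / q`!%:R :> R.
Proof.
case: q => // q; rewrite ltnS => le_q le_ab _.
have f x : 0 < x`!%:R :> R by rewrite ltr0n fact_gt0.
have -> : 2 ^+ q.+1 * q.+1%:R / q.+1`!%:R = 2 ^+ q.+1 / q`!%:R :> R.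
  rewrite factS natrM; field; rewrite !gt_eqF //=.
rewrite -[leLHS]div1r ler_pdivrMr ?mulr_gt0 // mulrAC ler_pdivlMr // mul1r.
rewrite -natrX -!natrM ler_nat.
apply: leq_trans (leq_fact le_q) _.
have := bin_fact (leq_addr b a); rewrite addKn => <-.
rewrite leq_mul //; apply: leq_trans (leq_pexp2l (m := 2) _ le_ab) => //.
have -> : (2 ^ (a + b) = \sum_(i < (a + b).+1) 'C(a + b, i) * (1 ^ (a + b - i) * 1 ^ i))%N.
  exact: (expnDn 1 1).
have lt_a : (a < (a + b).+1)%N by rewrite ltnS leq_addr.
by rewrite (bigD1 (Ordinal lt_a)) //= !exp1n !muln1 leq_addr.
Qed.

(** Each of the [n] terms with [m < n] is at most [3 / K * 2^q q / q!], and
    [n / K <= q+1]; the last term, [m = n], carries [smooth n <= 1 / q!]. *)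
Lemma conv_bound n M : (K <= n)%N -> (n <= M)%N ->
  \sum_(m < n.+1) smooth m * `|rough (n - m) - rough M| <=
  10 * (8 ^+ (n %/ K) / (n %/ K)`!%:R).
Proof.
move=> le_Kn le_nM; set q := (n %/ K)%N.
have q0 : (0 < q)%N by rewrite divn_gt0.
have f x : 0 < x`!%:R :> R by rewrite ltr0n fact_gt0.
have K0 : 0 < K%:R :> R by rewrite ltr0n.
rewrite big_ord_recr /= subnn.
apply: (@le_trans _ _ (\sum_(m < n) 3 / K%:R * (2 ^+ q * q%:R / q`!%:R) + q`!%:R^-1 * 4)).
  apply: lerD; last first.
    rewrite distrC ler_pM ?smooth_ge0 //; last exact: rough_tail0.
    by apply: smooth_factorial; apply: leq_divM.
  apply: ler_sum => m _; have lt_mn := ltn_ord m.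
  rewrite distrC.
  have := @rough_tail_pos R K isT (n - m)%N M; rewrite subn_gt0 lt_mn => /(_ isT).
  move=> /(_ (leq_trans (leq_subr _ _) le_nM)) H.
  apply: le_trans (ler_pM _ _ (smooth_factorial (leq_divM m K)) H) _; rewrite ?smooth_ge0 //.
  set a := (m %/ K)%N; set b := (_ %/ K)%N.
  rewrite invfM [X in X <= _](_ : _ = 3 / K%:R * (a`!%:R * b`!%:R)^-1); last first.
    by rewrite invfM; ring.
  rewrite ler_wpM2l ?divr_ge0 ?ler0n //; apply: inv_fact_mul_le => //.
    rewrite -ltnS /q ltn_divLR //.
    have := ltn_ceil m (ltn0Sn k); have := ltn_ceil (n - m).-1 (ltn0Sn k).
    rewrite -/a -/b; nia.
  rewrite /q leq_divRL // mulnDl.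
  have := leq_divM m K; have := leq_divM (n - m).-1 K; rewrite -/a -/b; lia.
rewrite sumr_const card_ord -[_ *+ n]mulr_natr.
rewrite [leRHS]mulrA [q`!%:R^-1 * _]mulrC.
have -> : 3 / K%:R * (2 ^+ q * q%:R / q`!%:R) * n%:R =
   (3 * (2 ^+ q * q%:R) * (n%:R / K%:R)) / q`!%:R :> R by ring.
rewrite -mulrDl ler_wpM2r ?invr_ge0 ?(ltW (f _)) //.
have nK : n%:R / K%:R <= q.+1%:R :> R.
  by rewrite ler_pdivrMr // -natrM ler_nat ltnW // ltn_ceil.
apply: le_trans (lerD (ler_wpM2l _ nK) (lexx _)) _.
  by rewrite !mulr_ge0 ?exprn_ge0 ?ler0n.
rewrite -!natrX -!natrM -natrD ler_nat.
have lt_q2 := ltn_expl q (ltnSn 1).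
have -> : (8 ^ q = 2 ^ q * (2 ^ q * 2 ^ q))%N by rewrite -!expnMn.
set t := (2 ^ q)%N in lt_q2 *.
have t0 : (0 < t)%N by rewrite expn_gt0.
have h : (q * q.+1 <= t * t)%N by rewrite leq_mul // ltnW.
have -> : (3 * (t * q) * q.+1 = 3 * t * (q * q.+1))%N by lia.
have h3 : (3 * t * (q * q.+1) <= 3 * t * (t * t))%N by rewrite leq_mul2l h orbT.
have h4 : (0 < t * (t * t))%N by rewrite !muln_gt0 t0.
by move: h3 h4; lia.
Qed.

Lemma factorial_dominates (x e : R) : 0 < e ->
  exists q0, forall q, (q0 <= q)%N -> 10 * (x ^+ q / q`!%:R) <= e.
Proof.
move=> e0; have := cvg_series_cvg_0 (is_cvg_series_exp_coeff x).
move=> /cvgrPdist_le /(_ (e / 10)); rewrite divr_gt0 ?ltr0n // => /(_ isT) [q0 _ H].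
exists q0 => q qq; have := H q qq; rewrite sub0r normrN => /(le_trans (ler_norm _)).
by rewrite ler_pdivlMr ?ltr0n // mulrC.
Qed.

(** For large [N], [rough N * sum_(m <= N) smooth m] is close to 1 by [total_mass]
    and [conv_bound]. So is [E * sum_(m <= N) smooth m] by assumption. As that sum
    is at least [smooth 0 = 1], [rough N] is close to [E], and [conv_bound] with
    [M = N] passes to the limit. *)
Lemma conv_limit_bound (E : R) n : (K <= n)%N ->
  (forall e, 0 < e -> exists N0, forall N, (N0 <= N)%N ->
     `|1 - E * \sum_(m < N.+1) smooth m| <= e) ->
  \sum_(m < n.+1) smooth m * `|rough (n - m) - E| <=
  10 * (8 ^+ (n %/ K) / (n %/ K)`!%:R).
Proof.
move=> le_Kn HE; apply/ler_addgt0Pr => e e0.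
pose S N : R := \sum_(m < N.+1) smooth m.
have S1 N : 1 <= S N.
  by rewrite /S big_ord_recl smooth0 lerDl sumr_ge0 // => i _; exact: smooth_ge0.
have S0 : 0 < S n by apply: lt_le_trans (S1 n).
pose d := e / S n / 2; have d0 : 0 < d by rewrite !divr_gt0.
have [N0 HN0] := HE d d0.
have [q0 Hq0] := factorial_dominates 8 d0.
pose N := maxn (maxn N0 n) (q0 * K).
have [NN0 Nn Nq] : [/\ (N0 <= N)%N, (n <= N)%N & (q0 * K <= N)%N] by rewrite /N; split; lia.
have rE : `|rough N - E| <= 2 * d.
  apply: (@le_trans _ _ (`|rough N - E| * S N)); first by rewrite ler_peMr.
  have S0N : 0 <= S N by apply: le_trans (S1 N).
  rewrite -{1}(ger0_norm S0N) -normrM.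
  have -> : (rough N - E) * S N = (1 - E * S N) - (1 - rough N * S N) by ring.
  apply: le_trans (ler_normB _ _) _; rewrite mulr_natl mulr2n lerD ?HN0 //.
  rewrite -(total_mass N) /S mulr_sumr -sumrB.
  apply: le_trans (ler_norm_sum _ _ _) _.
  apply: le_trans _ (Hq0 (N %/ K)%N _); last by rewrite leq_divRL.
  apply: le_trans _ (conv_bound (leq_trans le_Kn Nn) (leqnn N)).
  apply: ler_sum => m _; rewrite [rough N * _]mulrC -mulrBr normrM ger0_norm ?smooth_ge0 //.
apply: (@le_trans _ _ (\sum_(m < n.+1) (smooth m * `|rough (n - m) - rough N| + smooth m * (2 * d)))).
  apply: ler_sum => m _; rewrite -mulrDr ler_wpM2l ?smooth_ge0 //.
  have -> : rough (n - m) - E = (rough (n - m) - rough N) + (rough N - E) by ring.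
  by apply: le_trans (ler_normD _ _) _; rewrite lerD2l.
rewrite big_split /= -mulr_suml -/(S n); apply: lerD; first exact: conv_bound.
by rewrite /d; have -> : S n * (2 * (e / S n / 2)) = e by field; rewrite gt_eqF.
Qed.
End Convolution.

(** * From factorials to exponentials *)

(** From [u^q / q! <= e^u] and [q >= u - 1] one gets
    [1 / q! <= exp (u - (u - 1) ln u)]; the factor [8^q] costs [e^(3u)], the
    constant 10 costs [e^(4u)], and [ln u <= u]. *)
Lemma factorial_tail_bound (R : realType) (u : R) (q : nat) :
  1 <= u -> q%:R <= u -> u <= q.+1%:R ->
  10 * (8 ^+ q / q`!%:R) <= expR (- (u * ln u - 9 * u)).
Proof.
move=> u1 qu uq; have u0 : 0 < u by apply: lt_le_trans u1.
have lnu0 : 0 <= ln u by exact: ln_ge0.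
have lnu : ln u <= u.
  have := @le_ln1Dx R (u - 1); rewrite addrCA subrr addr0 => H.
  by apply: le_trans (H _) _; lra.
have e2 : 2 <= expR 1 :> R.
  by have := @expR_ge1Dx R 1; rewrite (_ : 1 + 1 = 2).
have e2n n : 2 ^+ n <= expR n%:R :> R.
  by rewrite -[n%:R]mulr1 expRM_natl lerXn2r ?nnegrE ?expR_ge0.
have f0 : 0 < q`!%:R :> R by rewrite ltr0n fact_gt0.
have uqe : u ^+ q / q`!%:R <= expR u.
  case: (q) => [|p]; first by rewrite expr0 fact0 divr1 -[leLHS]expR0 ler_expR ltW.
  by apply: le_trans (expR_ge1Dxn p (ltW u0)); rewrite lerDr.
have h8 : 8 ^+ q <= expR (3 * u).
  apply: (@le_trans _ _ (expR (3 * q)%:R)).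
    by rewrite (_ : 8 = 2 ^+ 3) -?exprM ?e2n //; rewrite -natrX.
  by rewrite ler_expR natrM ler_pM2l.
have h10 : 10 <= expR (4 * u).
  apply: (@le_trans _ _ (expR 4%:R)); last by rewrite ler_expR ler_peMr.
  by apply: le_trans (e2n 4%N); rewrite -natrX ler_nat.
have hq : q`!%:R^-1 <= expR (u - (u - 1) * ln u).
  rewrite expRD expRN ler_pdivlMr ?expR_gt0 //.
  rewrite mulrC; apply: le_trans uqe; rewrite ler_pM2r ?invr_gt0 //.
  rewrite -[u in leRHS](lnK (x := u)) ?posrE // -expRM_natl ler_expR.
  by rewrite ler_wpM2r // lerBlDr natr1.
have f1 : 0 <= q`!%:R^-1 :> R by rewrite invr_ge0 ltW.
apply: (@le_trans _ _ (expR (4 * u) * (expR (3 * u) * expR (u - (u - 1) * ln u)))).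
  by rewrite !ler_pM // ?mulr_ge0 ?exprn_ge0.
rewrite -!expRD ler_expR; lra.
Qed.

(** * Laws of discrete random variables *)

Section DiscretePreimages.
Context d (T : measurableType d) (R : realType) (mu : probability T R).
Context (Omega : choiceType) (f : T -> Omega).
Hypothesis mf : forall x, measurable (f @^-1` [set x]).

Lemma preimage_cons x (L : seq Omega) :
  f @^-1` [set` x :: L] = f @^-1` [set x] `|` f @^-1` [set` L].
Proof.
rewrite -preimage_setU; congr (_ @^-1` _); apply/seteqP; split => y /=.
  by rewrite inE => /orP[/eqP|]; [left|right].
by case=> [->|yL]; rewrite inE ?eqxx // yL orbT.
Qed.

Lemma measurable_preimage_seq (L : seq Omega) : measurable (f @^-1` [set` L]).
Proof.
elim: L => [|x L IHL]; last by rewrite preimage_cons; apply: measurableU.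
by rewrite (_ : _ @^-1` _ = set0) //; apply/seteqP; split.
Qed.

Lemma measure_preimage_seq (L : seq Omega) : uniq L ->
  mu (f @^-1` [set` L]) = (\sum_(x <- L) mu (f @^-1` [set x]))%E.
Proof.
elim: L => [|x L IHL] /=.
  by rewrite big_nil (_ : _ @^-1` _ = set0) ?measure0 //; apply/seteqP; split.
case/andP=> xL uL; rewrite preimage_cons.
have disj : f @^-1` [set x] `&` f @^-1` [set` L] = set0.
  by apply/seteqP; split => // w [/= ->]; rewrite (negPf xL).
rewrite (measureU mu (mf x) (measurable_preimage_seq L) disj).
by rewrite big_cons -(IHL uL).
Qed.
End DiscretePreimages.

Lemma measurable_preimage_countable d (T : measurableType d) (Omega : countType)
    (f : T -> Omega) (U : set Omega) :
  (forall x, measurable (f @^-1` [set x])) -> measurable (f @^-1` U).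
Proof.
move=> mf.
have -> : f @^-1` U = \bigcup_(x : Omega) (if `[< U x >] then f @^-1` [set x] else set0).
  apply/seteqP; split => [w Uw|w [x _]]; first by exists (f w) => //; rewrite asboolT.
  by case: asboolP => //= Ux ->.
apply: countable_bigcupT_measurable => [|x]; last by case: ifP.
exact: countableP.
Qed.

(** * The Poisson vector *)

Section TupleOfMultiplicities.
Variable k : nat.

Definition mult_tuple (c : {ffun 'I_k -> nat}) : k.-tuple nat := [tuple c i | i < k].

Lemma mult_tuple_inj : injective mult_tuple.
Proof.
move=> c d cd; apply/ffunP => i.
by have := congr1 (fun t => tnth t i) cd; rewrite !tnth_mktuple.
Qed.

Lemma mult_tuple_surj (t : k.-tuple nat) : exists c, t = mult_tuple c.
Proof.
by exists [ffun i => tnth t i]; apply: eq_from_tnth => i; rewrite tnth_mktuple ffunE.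
Qed.

Lemma cycle_vectorE n (s : 'S_n) :
  cycle_vector k s = mult_tuple (short_cycles k [set: 'I_n]%SET s).
Proof.
apply: eq_from_tnth => i; rewrite !tnth_mktuple ffunE.
by apply: eq_card => C; rewrite !inE finset.subsetT.
Qed.
End TupleOfMultiplicities.

(** The probability that all coordinates of the Poisson vector vanish. *)
Definition poisson_zero (R : realType) (k : nat) : R := \prod_(i < k) expR (- i.+1%:R^-1).

Section PoissonVector.
Context d (T : measurableType d) (R : realType) (Q : probability T R) (k : nat).
Variable Z : 'I_k -> {RV Q >-> nat}.
Hypothesis indepZ : mutually_independent Z.
Hypothesis poisZ : forall i : 'I_k, poisson_distributed (Z i) (i.+1%:R^-1).

Lemma joint_preimage (c : {ffun 'I_k -> nat}) :
  joint Z @^-1` [set mult_tuple c] = \bigcap_(i in [set` [set: 'I_k]%SET]) (Z i @^-1` [set c i]).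
Proof.
apply/seteqP; split => w /=.
  move=> E i _ /=; have := congr1 (fun t => tnth t i) E.
  by rewrite !tnth_mktuple.
move=> E; apply: eq_from_tnth => i; rewrite !tnth_mktuple.
by apply: (E i); rewrite /= inE.
Qed.

Lemma joint_measurable (t : k.-tuple nat) : measurable (joint Z @^-1` [set t]).
Proof.
have [c ->] := mult_tuple_surj t; rewrite joint_preimage.
apply: fin_bigcap_measurable => // i _.
by rewrite -[X in measurable X]setTI; apply: measurable_funPT.
Qed.

Lemma joint_law (c : {ffun 'I_k -> nat}) :
  Q (joint Z @^-1` [set mult_tuple c]) = (cycle_wt R c * poisson_zero R k)%:E.
Proof.
rewrite joint_preimage indepZ // (eq_bigl predT); last by move=> i; rewrite inE.
under eq_bigr => i _.
  rewrite -[Q _]/(distribution Q (Z i) [set c i]) poisZ /poisson_prob.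
  rewrite invr_gt0 ltr0Sn esum_set1 ?lee_fin ?poisson_pmf_ge0 //.
  over.
rewrite prodEFin /cycle_wt /poisson_zero -big_split /=; congr (_%:E).
apply: eq_bigr => i _; rewrite /poisson_pmf invr_gt0 ltr0Sn; congr (_ * _).
by rewrite invfM exprVn mulrC.
Qed.

End PoissonVector.

Section WeightAtMost.
Variable k : nat.

Definition weight_le N : seq {ffun 'I_k -> nat} :=
  [seq c | m <- index_iota 0 N.+1, c <- of_weight k m].

Lemma mem_weight_le N c : (c \in weight_le N) = (weight c <= N)%N.
Proof.
apply/allpairsPdep/idP => [[m [d [+ + ->]]]|wN].
  by rewrite mem_index_iota mem_of_weight => ? /eqP ->.
by exists (weight c), c; rewrite mem_index_iota mem_of_weight eqxx.
Qed.

Lemma weight_le_uniq N : uniq (weight_le N).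
Proof.
apply: allpairs_uniq_dep; first exact: iota_uniq.
  by move=> m _; exact: of_weight_uniq.
move=> p q /allpairsPdep[m [c [_ + ->]]] /allpairsPdep[m' [c' [_ + ->]]] /=.
by rewrite !mem_of_weight => /eqP <- /eqP <- ->.
Qed.

Lemma sum_weight_le (V : nmodType) N (F : {ffun 'I_k -> nat} -> V) :
  \sum_(c <- weight_le N) F c = \sum_(m < N.+1) \sum_(c <- of_weight k m) F c.
Proof. by rewrite big_allpairs_dep big_mkord. Qed.

Lemma sum_weight_le_smooth (R : realType) N (g : nat -> R) :
  \sum_(c <- weight_le N) cycle_wt R c * g (weight c) =
  \sum_(m < N.+1) smooth R k m * g m.
Proof.
rewrite sum_weight_le; apply: eq_bigr => m _; rewrite mulr_suml big_seq [RHS]big_seq.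
by apply: eq_bigr => c; rewrite mem_of_weight => /eqP ->.
Qed.
End WeightAtMost.

Section PoissonMass.
Context d (T : measurableType d) (R : realType) (Q : probability T R) (k : nat).
Variable Z : 'I_k -> {RV Q >-> nat}.
Hypothesis indepZ : mutually_independent Z.
Hypothesis poisZ : forall i : 'I_k, poisson_distributed (Z i) (i.+1%:R^-1).

Lemma joint_law_seq (L : seq {ffun 'I_k -> nat}) : uniq L ->
  Q (joint Z @^-1` [set` map (@mult_tuple k) L]) =
  (\sum_(c <- L) cycle_wt R c * poisson_zero R k)%:E.
Proof.
move=> uL; have utL : uniq (map (@mult_tuple k) L).
  by rewrite map_inj_uniq //; exact: mult_tuple_inj.
rewrite (measure_preimage_seq Q (joint_measurable Z) utL).
rewrite big_map -sumEFin; apply: eq_bigr => c _; exact: joint_law.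
Qed.

(** The vector has finite weight everywhere, so the events that its weight is at
    most [N] increase to the whole space. *)
Lemma poisson_mass_limit (e : R) : 0 < e -> exists N0, forall N, (N0 <= N)%N ->
  `|1 - poisson_zero R k * \sum_(m < N.+1) smooth R k m| <= e.
Proof.
move=> e0.
pose F N := joint Z @^-1` [set` map (@mult_tuple k) (weight_le k N)].
have QF N : Q (F N) = (poisson_zero R k * \sum_(m < N.+1) smooth R k m)%:E.
  rewrite joint_law_seq ?weight_le_uniq //; congr (_%:E).
  by rewrite (sum_weight_le_smooth k N (fun=> poisson_zero R k)) -mulr_suml mulrC.
have mF N : measurable (F N) by apply: measurable_preimage_seq; exact: joint_measurable.
have FT : \bigcup_N F N = setT.
  apply/seteqP; split => // w _; have [c jc] := mult_tuple_surj (joint Z w).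
  exists (weight c) => //.
  suff: joint Z w \in map (@mult_tuple k) (weight_le k (weight c)) by [].
  by rewrite jc map_f // mem_weight_le.
have Fnd : {homo F : n m / (n <= m)%N >-> (n <= m)%O}.
  move=> n m nm; apply/subsetPset => w /= /mapP[c cn E]; rewrite /F /= E; apply: map_f.
  by move: cn; rewrite !mem_weight_le => /leq_trans; apply.
have cvgF := nondecreasing_cvg_mu (mu := Q) mF (bigcup_measurable (fun i _ => mF i)) Fnd.
have {cvgF} : (fun N => (poisson_zero R k * \sum_(m < N.+1) smooth R k m)%:E) @ \oo --> 1%E.
  rewrite -(probability_setT Q) -FT; apply: cvg_trans cvgF.
  by apply: near_eq_cvg; apply: nearW => N /=; rewrite QF.
move=> /fine_cvgP[_] /cvgrPdist_le/(_ e e0)[N0 _ H].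
by exists N0 => N NN; have := H N NN.
Qed.
End PoissonMass.

(** * Comparison of the two laws *)

Section Comparison.
Context (R : realType) (n k : nat).
Context d1 (T1 : measurableType d1) (P : probability T1 R).
Context d2 (T2 : measurableType d2) (Q : probability T2 R).
Variables (sigma : T1 -> 'S_n) (Z : 'I_k.+1 -> {RV Q >-> nat}).
Hypothesis unif : uniform_permutation P sigma.
Hypothesis indepZ : mutually_independent Z.
Hypothesis poisZ : forall i : 'I_k.+1, poisson_distributed (Z i) (i.+1%:R^-1).

Lemma cycle_vector_law (U : set (k.+1.-tuple nat)) :
  P ((fun w => cycle_vector k.+1 (sigma w)) @^-1` U) =
  (\sum_(c <- weight_le k.+1 n | `[< U (mult_tuple c) >])
     cycle_wt R c * rough R k.+1 (n - weight c))%:E.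
Proof.
pose L := [seq s <- enum {perm 'I_n} | `[< U (cycle_vector k.+1 s) >]].
have -> : (fun w => cycle_vector k.+1 (sigma w)) @^-1` U = sigma @^-1` [set` L].
  by apply/seteqP; split => w /=; rewrite mem_filter mem_enum andbT => /asboolP.
have uL : uniq L by rewrite filter_uniq ?enum_uniq.
rewrite (measure_preimage_seq P (fun s => proj1 (unif s)) uL).
under eq_bigr => s _ do rewrite (proj2 (unif s)).
rewrite sumEFin; congr (_%:E); rewrite big_filter big_enum_cond /=.
have f0 : n`!%:R != 0 :> R by rewrite pnatr_eq0 -lt0n fact_gt0.
transitivity (\sum_(s : 'S_n) \sum_(c <- weight_le k.+1 n | `[< U (mult_tuple c) >])
     (short_cycles k.+1 [set: 'I_n]%SET s == c)%:R / n`!%:R : R).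
  rewrite big_mkcond; apply: eq_bigr => s _; rewrite cycle_vectorE.
  set c := short_cycles _ _ _.
  have cn : c \in weight_le k.+1 n.
    rewrite mem_weight_le -[leqRHS]card_ord -cardsT; apply: (weight_short_cycles R) => //.
    by apply/fintype.subsetP => z _; rewrite inE.
  rewrite big_mkcond (bigD1_seq c) ?weight_le_uniq //= eqxx mul1r big1 ?addr0 // => c' c'c.
  by rewrite eq_sym (negPf c'c) mul0r if_same.
rewrite exchange_big /= big_seq_cond [RHS]big_seq_cond; apply: eq_bigr => c /andP[cn _].
rewrite -mulr_suml num_short_cycles_Sn /rough_rest; move: cn; rewrite mem_weight_le => ->.
by field.
Qed.

(** The cycle vector has weight at most [n]. The part of [U] of larger weight
    enters only through the subtracted Poisson mass, hence can be dropped. *)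
Lemma dTV_le : (k.+1 <= n)%N ->
  (dTV P Q (fun w => cycle_vector k.+1 (sigma w)) (joint Z) <=
   (10 * (8 ^+ (n %/ k.+1) / (n %/ k.+1)`!%:R))%:E)%E.
Proof.
move=> le_kn; apply: ge_ereal_sup => _ [U _ <-].
pose L := [seq c <- weight_le k.+1 n | `[< U (mult_tuple c) >]].
have QU : ((\sum_(c <- L) cycle_wt R c * poisson_zero R k.+1)%:E <= Q (joint Z @^-1` U))%E.
  rewrite -(joint_law_seq indepZ poisZ) ?filter_uniq ?weight_le_uniq //; apply: le_measure.
  - by rewrite inE; apply: measurable_preimage_seq; exact: joint_measurable.
  - by rewrite inE; apply: measurable_preimage_countable; exact: joint_measurable.
  by move=> w /= /mapP[c]; rewrite mem_filter => /andP[/asboolP Uc _] ->.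
rewrite cycle_vector_law.
apply: le_trans (leeB (lexx _) QU) _.
rewrite -EFinB lee_fin.
apply: le_trans (conv_limit_bound le_kn (poisson_mass_limit indepZ poisZ)).
rewrite -(sum_weight_le_smooth k.+1 n (fun m => `|rough R k.+1 (n - m) - poisson_zero R k.+1|)).
rewrite /L big_filter -sumrB big_mkcond; apply: ler_sum => c _.
have c0 := ltW (cycle_wt_gt0 R c).
case: ifP => _; last by rewrite mulr_ge0.
by rewrite -mulrBr ler_wpM2l // ler_norm.
Qed.

Lemma dTV_le1 : (dTV P Q (fun w => cycle_vector k.+1 (sigma w)) (joint Z) <= 1)%E.
Proof.
apply: ge_ereal_sup => _ [U _ <-].
rewrite leeBlDr ?fin_num_measure //; last first.
  by apply: measurable_preimage_countable; exact: joint_measurable.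
apply: (@le_trans _ _ 1%E); last by rewrite leeDl.
apply: probability_le1.
have -> : (fun w => cycle_vector k.+1 (sigma w)) @^-1` U =
   sigma @^-1` [set s | U (cycle_vector k.+1 s)] by [].
by apply: measurable_preimage_countable => s; case: (unif s).
Qed.

End Comparison.

Theorem theorem1p19 (R : realType) :
  exists f : R -> R,
    [/\ forall x : R, 1 <= x <= 20 -> f x = 0,
        exists K : R, forall x : R, 20 <= x ->
          `|f x - (x * ln x - x * ln (ln (ln x)))| <= K * x &
        forall (n k : nat), (1 <= k)%N -> (k <= n)%N ->
        forall (d1 d2 : measure_display)
          (T1 : measurableType d1) (T2 : measurableType d2)
          (P : probability T1 R) (Q : probability T2 R)
          (sigma : T1 -> 'S_n) (Z : 'I_k -> {RV Q >-> nat}),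
          uniform_permutation P sigma ->
          mutually_independent Z ->
          (forall i : 'I_k, poisson_distributed (Z i) (i.+1%:R^-1)) ->
          (dTV P Q (fun w => cycle_vector k (sigma w)) (joint Z)
            <= (expR (- f (n%:R / k%:R)))%:E)%E].
Proof.
(* The constant 9 comes from [factorial_tail_bound]. Adding [`|lll 20|] to it
   makes [f u <= u * ln u - 9 * u] for [u > 20], because [lll] increases from
   20 on, [ln 20 > 1] making [ln (ln 20)] positive. *)
pose lll (x : R) := ln (ln (ln x)).
pose C : R := 9 + `|lll 20|.
pose f (x : R) := if x <= 20 then 0 else x * ln x - x * lll x - C * x.
have C0 : 0 <= C by rewrite addr_ge0.
exists f; split.
- by move=> x /andP[_ x20]; rewrite /f x20.
(* The last two terms of this constant serve only the point [x = 20], where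
   [f] vanishes. *)
- exists (C + `|ln 20| + `|lll 20|) => x x20.
  have x0 : 0 <= x by lra.
  rewrite /f; case: ifP => [le_x|_]; last first.
    rewrite (_ : _ - _ = - (C * x)); last by rewrite /lll; ring.
    rewrite normrN normrM (ger0_norm C0) (ger0_norm x0) ler_wpM2r //.
    by rewrite -addrA lerDl addr_ge0.
  have -> : x = 20 by apply/eqP; rewrite eq_le le_x.
  rewrite sub0r normrN -mulrBr normrM mulrC (@ger0_norm _ 20) ?ler0n // ler_wpM2r ?ler0n //.
  apply: le_trans (ler_normB _ _) _; rewrite -addrA lerDr //.
move=> n [//|k] _ le_kn d1 d2 T1 T2 P Q sigma Z unif indepZ poisZ.
set u : R := n%:R / k.+1%:R.
have k0 : 0 < k.+1%:R :> R by rewrite ltr0n.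
rewrite /f; case: ifP => [_|/negbT]; first by rewrite oppr0 expR0 dTV_le1.
rewrite -ltNge => u20.
apply: le_trans (dTV_le unif indepZ poisZ le_kn) _; rewrite lee_fin.
apply: le_trans (@factorial_tail_bound R u (n %/ k.+1) _ _ _) _.
- lra.
- by rewrite ler_pdivlMr // -natrM ler_nat leq_divM.
- by rewrite ler_pdivrMr // -natrM ler_nat ltnW // ltn_ceil.
rewrite ler_expR lerN2.
have ln20 : 1 < ln 20 :> R.
  rewrite -[ltLHS]expRK ltr_ln ?posrE ?expR_gt0 ?ltr0n //.
  have e2 : 2^-1 <= expR (- 2^-1) :> R by apply: le_trans (expR_ge1Dx _); lra.
  have e1 : expR 1 * (expR (- 2^-1) * expR (- 2^-1)) = 1 :> R.
    by rewrite -!expRD (_ : _ + _ = 0) ?expR0 //; lra.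
  have := expR_gt0 (1 : R); nra.
have lnu : ln 20 <= ln u by rewrite ler_ln ?posrE ?ltW //; lra.
have lll_u : lll 20 <= lll u.
  have a : 0 < ln (ln 20) :> R by rewrite ln_gt0.
  have b : ln (ln 20) <= ln (ln u) by rewrite ler_ln ?posrE //; lra.
  by rewrite /lll ler_ln ?posrE //; lra.
have : - `|lll 20| <= lll u by apply: le_trans lll_u; rewrite lerNl -normrN ler_norm.
rewrite /C; nra.
Qed.
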